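(* Let $\{p_i\}_1^n\subset\mathbb{R}^2$ be a closed ordinary mesh and $1<m<n$. Start from $p_1$ and connect every $m$-th point by a straight line (i.e. pass from $p_i$ to $p_{i+m}$, indices modulo $n$) until getting back to $p_1$ for the first time. Then the following are equivalent: (i) all points of the mesh are met; (ii) the return to the starting point occurs after exactly $n$ steps; (iii) $\gcd(m,n)=1$.
   Context: A closed mesh is a cyclically ordered list of $n$ points $p_1,\dots,p_n$ in the plane, with indices read modulo $n$; it is ordinary if there is no $i$ with $p_{i+1}=p_{i-1}$. Points are identified with their indices in $\mathbb{Z}/n\mathbb{Z}$, so ''getting back to $p_1$'' means the index returns to $1$ modulo $n$. One step is the passage from index $i$ to index $i+m$ modulo $n$. *)

(* Defs.v *)
From mathcomp Require Import all_boot all_order all_algebra.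
From mathcomp Require Import reals.
Set Implicit Arguments.
Unset Strict Implicit.
Unset Printing Implicit Defensive.
Import GRing.Theory.
Local Open Scope ring_scope.

(* The point p_i is [p i] with i in Z/nZ, so p_n is [p 0].
   ['Z_n] is Z/nZ only when 1 < n. *)
Definition closed_mesh (R : realType) (n : nat) := 'Z_n -> 'rV[R]_2.

Definition ordinary (R : realType) (n : nat) (p : closed_mesh R n) :=
  ~ exists i : 'Z_n, p (i + 1) = p (i - 1).

(* Index reached after k steps i -> i + m from the index 1.  Distinct indices
   are distinct entries of the mesh even when their positions in the plane
   coincide, so the walk lives on the indices. *)
Definition walk (n m k : nat) : 'Z_n := iter k (fun i => i + m%:R) 1.

Definition returns (n m : nat) : pred nat :=
  fun k => (0 < k)%N && (walk n m k == 1).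

Lemma walkE n m k : walk n m k = 1 + m%:R *+ k.
Proof. by elim: k => [|k IHk] /=; rewrite ?addr0 // mulrSr addrA -IHk. Qed.

Lemma returns_ex n m : exists k, returns n m k.
Proof.
exists (Zp_trunc n).+2; rewrite /returns walkE -mulrnA mulnC mulrnA.
by rewrite (pchar_Zp (p := (Zp_trunc n).+2)) // mul0rn addr0 eqxx.
Qed.

Definition first_return (n m : nat) : nat := ex_minn (returns_ex n m).

Definition met (n m : nat) (i : 'Z_n) :=
  exists2 k, (k <= first_return n m)%N & walk n m k = i.

(* Main.v *)
Require Import Defs.
From mathcomp Require Import all_boot all_order all_algebra.
From mathcomp Require Import reals.
Import GRing.Theory.

(** The walk is the orbit of the index 1 under translation by m in Z/nZ, and
    the equivalences follow from two facts about the time of first return r.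

    Translations are injective, so two visits to the same index at times
    j < k force a return at time k - j; hence the walk visits r distinct
    indices before its first return ([walk_inj]).  The return visits
    nothing new, so exactly r indices are met, and they are all of Z/nZ if and
    only if r = n ([all_met_first_return]).

    A return at time k means n | m k.  Cancelling g = gcd(m, n), this says that
    n / g divides k, so r = n / g ([first_returnE]), which is n precisely when
    g = 1. *)

Lemma walk_start_dvdn n m k :
  1 < n -> (walk n m k == 1%R) = (n %| m * k).
Proof.
move=> n_gt1; rewrite walkE -subr_eq0 addrC addKr -mulrnA.
by rewrite -Zp_nat_mod // -val_eqE /= val_Zp_nat // modn_mod.
Qed.

Lemma walk_cancel n m j k : j <= k ->
  (walk n m j == walk n m k) = (walk n m (k - j) == 1%R).
Proof.
move=> le_jk; rewrite !walkE eq_sym (inj_eq (addrI _)).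
by rewrite -subr_eq0 -mulrnBr // -[RHS]subr_eq0 [in RHS]addrC addKr.
Qed.

Lemma first_return_returns n m : returns n m (first_return n m).
Proof. by rewrite /first_return; case: ex_minnP. Qed.

Lemma first_return_min n m k : returns n m k -> first_return n m <= k.
Proof. by rewrite /first_return; case: ex_minnP => r _ min_r /min_r. Qed.

(** Two equal values at times j < k would be a return at time k - j, which is
    earlier than the first one. *)
Lemma walk_inj n m :
  {in gtn (first_return n m) &, injective (walk n m)}.
Proof.
move=> j k; rewrite !inE => lt_jr lt_kr eq_jk.
wlog lt_jk: j k lt_jr lt_kr eq_jk / j < k => [wlog_lt|].
  case: (ltngtP j k) => // [lt_jk | lt_kj]; first exact: wlog_lt.
  by apply/esym/wlog_lt.
suff /first_return_min: returns n m (k - j).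
  by rewrite leqNgt (leq_ltn_trans (leq_subr j k)).
by rewrite /returns subn_gt0 lt_jk -walk_cancel ?eq_jk ?eqxx // ltnW.
Qed.

Definition walk_cycle n m : seq 'Z_n :=
  [seq walk n m k | k <- iota 0 (first_return n m)].

Lemma walk_cycle_uniq n m : uniq (walk_cycle n m).
Proof.
rewrite map_inj_in_uniq ?iota_uniq // => j k.
by rewrite !mem_iota => lt_jr lt_kr; apply: walk_inj.
Qed.

(** At the time of first return the walk is where it was at time 0, so that
    time contributes no index beyond those of the cycle. *)
Lemma met_walk_cycle n m (i : 'Z_n) : met m i <-> i \in walk_cycle n m.
Proof.
have /andP[r_gt0 /eqP walk_r] := first_return_returns n m.
split=> [[k] | /mapP[k]]; last first.
  by rewrite mem_iota => lt_kr ->; exists k => //; apply: ltnW.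
rewrite leq_eqVlt => /predU1P[-> | lt_kr] <-; apply/mapP.
  by exists 0; rewrite ?mem_iota.
by exists k; rewrite ?mem_iota.
Qed.

(** A duplicate-free list of r elements of the n-element set Z/nZ exhausts it
    if and only if r = n. *)
Lemma all_met_first_return n m : 1 < n ->
  (forall i : 'Z_n, met m i) <-> first_return n m = n.
Proof.
move=> n_gt1.
have card_Zn : #|'Z_n| = n by rewrite card_ord Zp_cast.
have card_cycle : #|walk_cycle n m| = first_return n m.
  by rewrite (card_uniqP (walk_cycle_uniq n m)) size_map size_iota.
split=> [all_met | r_eq_n i].
  rewrite -card_cycle -[RHS]card_Zn; apply: eq_card => i.
  by apply/met_walk_cycle.
apply/met_walk_cycle; move: i; apply/subset_cardP; last exact: subset_predT.
by rewrite card_cycle card_Zn.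
Qed.

Lemma first_returnE n m : 1 < n -> first_return n m = n %/ gcdn m n.
Proof.
move=> n_gt1; have n_gt0 := ltnW n_gt1.
have g_gt0 : 0 < gcdn m n by rewrite gcdn_gt0 n_gt0 orbT.
have Eg_n := divnK (dvdn_gcdr m n); have Eg_m := divnK (dvdn_gcdl m n).
(* Cancelling the gcd on both sides leaves coprime factors, and Gauss's lemma
   then removes the one coming from m. *)
have dvd_iff k : (n %| m * k) = (n %/ gcdn m n %| k).
  rewrite -[in LHS]Eg_n -[X in _ %| X * k]Eg_m mulnAC dvdn_pmul2r //.
  rewrite Gauss_dvdr // /coprime -(eqn_pmul2r g_gt0) muln_gcdl Eg_n Eg_m.
  by rewrite mul1n gcdnC.
have /andP[r_gt0] := first_return_returns n m.
rewrite walk_start_dvdn // dvd_iff => /(dvdn_leq r_gt0) le_r.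
apply/eqP; rewrite eqn_leq le_r andbT first_return_min //.
rewrite /returns walk_start_dvdn // dvd_iff dvdnn andbT.
by rewrite divn_gt0 // dvdn_leq // dvdn_gcdr.
Qed.

Theorem mainTheorem12 (R : realType) (n m : nat) (p : closed_mesh R n)
    (hp : ordinary p) (hm : 1 < m) (hmn : m < n) :
  ((forall i : 'Z_n, met m i) <-> first_return n m = n) /\
  (first_return n m = n <-> gcdn m n = 1).
Proof.
have n_gt1 : 1 < n := ltn_trans hm hmn.
split; first exact: all_met_first_return.
rewrite first_returnE //; split=> [quo_n | ->]; last exact: divn1.
apply/eqP; rewrite -(eqn_pmul2l (ltnW n_gt1)) muln1.
by rewrite -[X in X * _]quo_n divnK ?dvdn_gcdr.
Qed.
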